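(* For every $\varepsilon>0$ small enough, there is no deterministic comparison-based streaming algorithm that finds an $\varepsilon$-approximate median of the stream (an item whose rank $k'$ satisfies $|k'-N/2|\le\varepsilon N$, where $N$ is the stream length) and that stores $o\!\left(\frac{1}{\varepsilon}\log(\varepsilon N)\right)$ items on every input stream of length $N$.
   Context: Items come from a totally ordered universe $U$ which is unbounded and continuous: every non-empty open interval of $U$ contains arbitrarily many items. For a stream $\sigma$ of distinct items, the rank of an item $a$ is one plus the number of items of $\sigma$ strictly smaller than $a$. A deterministic streaming algorithm $\mathcal{D}$ is comparison-based if: (i) it performs no operation on stream items other than comparisons and equality tests; (ii) its memory is split into an item array $I$, storing only items that have already occurred in the stream (kept sorted), and a general memory $G$ containing no item identifiers; once an item is removed from $I$ it cannot be added back unless it appears again in the stream; (iii) on arrival of an item $a_i$, its computation is determined solely by the results of comparisons between $a_i$ and the entries of $I$, by $|I|$, and by $G$; (iv) its output is determined solely by $|I|$ and $G$, and it can only output an item stored in $I$. Space is measured as the number of items stored in $I$. *)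

(* Defs.v *)
From HB Require Import structures.
From mathcomp Require Import all_boot all_order all_algebra.
From mathcomp Require Import all_classical all_reals all_analysis.

Set Implicit Arguments.
Unset Strict Implicit.
Unset Printing Implicit Defensive.

Import Order.TTheory GRing.Theory Num.Theory.
Import numFieldNormedType.Exports.

Local Open Scope classical_set_scope.
Local Open Scope ring_scope.

Definition unbounded_continuous (d : Order.disp_t) (U : orderType d) : Prop :=
  [/\ inhabited U,
      forall x : U, (exists y : U, (y < x)%O) /\ (exists z : U, (x < z)%O)
    & forall x y : U, (x < y)%O -> forall n : nat, exists s : seq U,
        [/\ uniq s, size s = n & forall z, z \in s -> (x < z < y)%O] ].

(* Comparison-basedness is built into the types: the components of an
   algorithm never receive an item.
   - [step g cs], where [cs] lists the results of comparing the arriving item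
     with the entries of the item array (so [size cs] is the array's length),
     gives the new general memory and a list of positions describing the new
     item array: a position inside the array refers to the entry stored there,
     any other position refers to the arriving item.
   - [out g n] is the position, in an item array of length [n], of the item
     that is output. *)
Record cb_algorithm := CBAlgorithm {
  general_memory : Type;
  init : general_memory;
  step : general_memory -> seq (bool * bool) -> general_memory * seq nat;
  out : general_memory -> nat -> nat
}.

Section Execution.
Context (d : Order.disp_t) (U : orderType d).

Definition comparisons (a : U) (items : seq U) : seq (bool * bool) :=
  [seq ((a < x)%O, a == x) | x <- items].

Definition arrive (A : cb_algorithm) (m : general_memory A * seq U) (a : U) :
    general_memory A * seq U :=
  let: (g, items) := m in
  let: (g', js) := step g (comparisons a items) in
  (g', sort <=%O [seq nth a items j | j <- js]).

Definition run (A : cb_algorithm) (sigma : seq U) : general_memory A * seq U :=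
  foldl (@arrive A) (init A, [::]) sigma.

Definition output (A : cb_algorithm) (sigma : seq U) : option U :=
  let: (g, items) := run A sigma in onth items (out g (size items)).

(* The largest size of the item array at any time while reading [sigma]. *)
Definition items_stored (A : cb_algorithm) (sigma : seq U) : nat :=
  \max_(i < (size sigma).+1) size (run A (take i sigma)).2.

Definition item_rank (sigma : seq U) (a : U) : nat :=
  (count (fun x => (x < a)%O) sigma).+1.

Definition approx_median (R : realType) (eps : R) (sigma : seq U) (a : U) :
    Prop :=
  a \in sigma /\
  `|(item_rank sigma a)%:R - (size sigma)%:R / 2| <= eps * (size sigma)%:R.

(* A stream of odd length [N] has no [eps]-approximate median when
   [eps * N < 1/2] (e.g. [N = 1]), so nothing is required on such streams. *)
Definition finds_approx_median (R : realType) (A : cb_algorithm) (eps : R) :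
    Prop :=
  forall sigma : seq U, uniq sigma ->
    (exists a, approx_median eps sigma a) ->
    exists2 a, output A sigma = Some a & approx_median eps sigma a.

Definition stores_at_most (R : realType) (A : cb_algorithm) (s : nat -> R) :
    Prop :=
  forall sigma : seq U, uniq sigma ->
    (items_stored A sigma)%:R <= s (size sigma).

End Execution.

Definition space_bound (R : realType) (eps : R) (N : nat) : R :=
  1 / eps * ln (eps * N%:R).

(* Main.v *)
Require Import Defs.
From HB Require Import structures.
From mathcomp Require Import all_boot all_order all_algebra.
From mathcomp Require Import all_classical all_reals all_analysis.
From mathcomp Require Import zify ring lra.

Set Implicit Arguments.
Unset Strict Implicit.
Unset Printing Implicit Defensive.

Import Order.TTheory GRing.Theory Num.Theory.
Import numFieldNormedType.Exports.

(* An adversary feeds two streams in parallel, i.e. a stream of pairs, so that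
   the algorithm cannot tell them apart.  A cut (x, y) separates the stored
   pairs into those with p.1 <= x and p.2 < y and those with p.1 > x and
   p.2 >= y; its gap is the number of second components below y minus the number
   of first components up to x.  Appending items at one end centres the gap of
   any cut at the median, so gaps are O(eps N).

   To play n 2^(k+1) pairs in a pair of empty intervals, play n 2^k pairs there,
   take a cut (x, y) of maximal gap, and play n 2^k more pairs immediately above
   x in the first stream and immediately below y in the second one.  Gaps add up:
   h1 + h2 <= h.  With S1, S2 the space used in the two phases and Q the number
   of pairs of the first phase retained until the end, the space S satisfies
   S >= S1 and S >= S2 + Q, while n 2^k <= (Q + 2) (h + 1).  Averaging the two
   bounds and linearising Q in h by AM-GM shows, by induction on k,
     S >= k (31/512 n - 1) - (k n / 256) (h / 2^k).
   For n about 1/eps we have h <= 8 * 2^k, and hence S = Omega(k / eps). *)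

(** * Auxiliary facts on sequences and orders *)

Lemma nth_map_default (S T : Type) (f : S -> T) (x : S) (s : seq S) (i : nat) :
  nth (f x) (map f s) i = f (nth x s i).
Proof. by elim: s i => [|y s IHs] [|i] //=. Qed.

Lemma sub_count_in (T : eqType) (a b : pred T) (s : seq T) :
  {in s, forall x, a x -> b x} -> count a s <= count b s.
Proof.
elim: s => //= x s IHs ab; apply: leq_add.
  by move: (ab x (mem_head _ _)); case: (a x) => // ->.
by apply: IHs => y ys; apply: ab; rewrite inE ys orbT.
Qed.

(** The target order is left general so that the dual order [U^d] turns the minimiser into a
    maximiser. *)
Lemma exists_argmin (d : Order.disp_t) (U : orderType d) (T : eqType)
    (f : T -> U) (a : pred T) (s : seq T) :
  has a s ->
  exists2 m, m \in s /\ a m & {in s, forall z, a z -> (f m <= f z)%O}.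
Proof.
elim: s => //= x s IHs; case: (boolP (has a s)) => [hs _ | ns].
  have [m [ms am] mmin] := IHs hs.
  case: (boolP (a x && (f x <= f m)%O)) => [/andP[ax xm] | nx].
    exists x; first by rewrite mem_head.
    move=> z; rewrite inE => /orP[/eqP -> // | zs az].
    exact: le_trans xm (mmin z zs az).
  exists m; first by rewrite inE ms orbT.
  move=> z; rewrite inE => /orP[/eqP -> ax | zs az]; last exact: mmin.
  by move: nx; rewrite ax /= -ltNge => /ltW.
rewrite orbF => ax; exists x; first by rewrite mem_head.
move=> z; rewrite inE => /orP[/eqP -> // | zs az].
by case/hasP: ns; exists z.
Qed.

Lemma exists_between (d : Order.disp_t) (U : orderType d) :
  unbounded_continuous U ->
  forall x y : U, (x < y)%O -> exists z, (x < z < y)%O.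
Proof.
move=> [_ _ den] x y /den/(_ 1)[[|z [|? ?]] [_ // _ hz]].
by exists z; apply: hz; rewrite mem_head.
Qed.

(** * Indistinguishable streams and their paired run *)

Section PairedRun.
Context (d : Order.disp_t) (U : orderType d) (A : cb_algorithm).
Implicit Types (tau delta : seq (U * U)) (p q : U * U) (x y z : U).

(* A single run serves two streams at once: it reads pairs and decides by the
   first components, so it is a run on the second components as well as long
   as these compare in the same way with the stored items. *)
Definition paired_arrive (m : general_memory A * seq (U * U)) p :=
  let: (g, items) := m in
  let: (g', js) := step g (comparisons p.1 (unzip1 items)) in
  (g', sort (relpre fst <=%O) [seq nth p items j | j <- js]).

Definition paired_run tau := foldl paired_arrive (init A, [::]) tau.

Definition stored tau := (paired_run tau).2.

Lemma run_unzip1 tau :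
  run A (unzip1 tau) = ((paired_run tau).1, unzip1 (stored tau)).
Proof.
elim/last_ind: tau => [|tau p] //.
rewrite /stored /paired_run /run /unzip1 map_rcons !foldl_rcons => ->.
case: (foldl _ _ tau) => g items /=.
case: (step _ _) => g' js /=; congr pair; rewrite -sort_map -map_comp.
by congr sort; apply: eq_map => j; rewrite /= nth_map_default.
Qed.

Lemma stored_rcons tau p q :
  q \in stored (rcons tau p) -> q = p \/ q \in stored tau.
Proof.
rewrite /stored /paired_run foldl_rcons.
case: (foldl _ _ tau) => g items /=; case: (step _ _) => g' js /=.
rewrite mem_sort => /mapP[j _ ->]; case: (ltnP j (size items)) => hj.
  by right; rewrite mem_nth.
by left; rewrite nth_default.
Qed.

Lemma stored_cat tau delta q :
  q \in stored (tau ++ delta) -> q \in delta \/ q \in stored tau.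
Proof.
elim/last_ind: delta => [|delta p IH]; first by rewrite cats0; right.
rewrite -rcons_cat mem_rcons inE => /stored_rcons[-> | /IH[]->]; last by right.
- by rewrite eqxx; left.
- by rewrite orbT; left.
Qed.

Lemma mem_stored tau q : q \in stored tau -> q \in tau.
Proof. by move=> /(@stored_cat [::] tau)[]. Qed.

Definition coherent (M : seq (U * U)) : Prop :=
  {in M &, forall p q, (p.1 <= q.1)%O = (p.2 <= q.2)%O}.

(** The last clause is indistinguishability: both runs reach the same general memory and hold the
    two sides of the same pairs, so they output the two components of one pair. *)
Definition twin tau : Prop :=
  [/\ uniq (unzip1 tau), uniq (unzip2 tau), coherent (stored tau)
    & run A (unzip2 tau) = ((paired_run tau).1, unzip2 (stored tau))].

Lemma twin_nil : twin [::].
Proof. by []. Qed.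

Lemma coherent_lt M p q : coherent M -> p \in M -> q \in M ->
  (p.1 < q.1)%O = (p.2 < q.2)%O.
Proof. by move=> coh pM qM; rewrite !ltNge coh. Qed.

(** If both components of the new pair compare alike with the stored ones, [step] receives the same
    arguments in both runs and selects the same positions. *)
Lemma twin_rcons tau p : twin tau -> p.1 \notin unzip1 tau ->
  p.2 \notin unzip2 tau ->
  {in stored tau, forall q, (p.1 < q.1)%O = (p.2 < q.2)%O} ->
  twin (rcons tau p).
Proof.
move=> [u1 u2 coh run2] p1 p2 cmp.
have ne1 q : q \in stored tau -> (p.1 == q.1) = false.
  move=> /mem_stored qt; apply/negbTE/eqP => e.
  by case/negP: p1; rewrite e map_f.
have ne2 q : q \in stored tau -> (p.2 == q.2) = false.
  move=> /mem_stored qt; apply/negbTE/eqP => e.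
  by case/negP: p2; rewrite e map_f.
have le_p q : q \in stored tau -> (p.1 <= q.1)%O = (p.2 <= q.2)%O.
  by move=> qs; rewrite !le_eqVlt ne1 // ne2 // cmp.
have ge_p q : q \in stored tau -> (q.1 <= p.1)%O = (q.2 <= p.2)%O.
  by move=> qs; rewrite !leNgt cmp.
have coh' : coherent (p :: stored tau).
  move=> q r; rewrite !inE => /orP[/eqP->|qs] /orP[/eqP->|rs].
  - by rewrite !lexx.
  - exact: le_p.
  - exact: ge_p.
  - exact: coh.
have cmpE : comparisons p.2 (unzip2 (stored tau)) =
            comparisons p.1 (unzip1 (stored tau)).
  rewrite /comparisons -!map_comp; apply/eq_in_map => q qs /=.
  by rewrite cmp // ne1 // ne2.
split.
- by rewrite /unzip1 map_rcons rcons_uniq p1.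
- by rewrite /unzip2 map_rcons rcons_uniq p2.
- by move=> q r /stored_rcons qs /stored_rcons rs; apply: coh';
    rewrite inE; apply/orP;
    [case: qs => [->|->] | case: rs => [->|->]]; rewrite ?eqxx; auto.
move: run2 cmpE coh'; rewrite /stored /paired_run /run /unzip2 map_rcons.
rewrite !foldl_rcons => ->; case: (foldl _ _ tau) => g items /= ->.
case: (step _ _) => g' js /= coh'; congr pair.
set L := [seq nth p items j | j <- js].
have -> : [seq nth p.2 [seq q.2 | q <- items] j | j <- js] = map snd L.
  by rewrite -map_comp; apply: eq_map => j; rewrite /= nth_map_default.
have LP : all (mem (p :: items)) L.
  apply/allP => q /mapP[j _ ->]; rewrite /= inE.
  by case: (ltnP j (size items)) => hj;
    [rewrite mem_nth ?orbT | rewrite nth_default ?eqxx].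
(* Projection commutes with sorting: on a coherent set the two component orders agree, and equality
   of one component forces equality of the other. *)
apply: (homo_sort_map_in _ _ _ _ LP).
- move=> [q1 q2] [r1 r2] qs rs /= /andP[h h'].
  have /= e := coh' _ _ qs rs; have /= e' := coh' _ _ rs qs.
  by congr pair; apply/le_anti; rewrite ?h ?h' // e e' h.
- by move=> q r t _ _ _ /=; apply: le_trans.
- by move=> q r _ _ /=; apply: le_total.
- by move=> q r qs rs /=; rewrite coh'.
Qed.


(** * Cuts, and empty intervals in which to play *)

Definition le_fst tau x := count (fun p => p.1 <= x)%O tau.
Definition lt_fst tau x := count (fun p => p.1 < x)%O tau.
Definition lt_snd tau y := count (fun p => p.2 < y)%O tau.

Definition cut tau x y : Prop :=
  {in stored tau, forall p, (p.1 <= x)%O = (p.2 < y)%O}.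

(** A pair of empty open intervals for the adversary. The cut condition puts every stored pair on
    the same side of both intervals, so pairs played inside look alike in the two streams. *)
Definition slot tau l1 r1 l2 r2 : Prop :=
  [/\ (l1 < r1)%O, (l2 < r2)%O,
      {in tau, forall p, (p.1 <= l1)%O || (r1 <= p.1)%O},
      {in tau, forall p, (p.2 <= l2)%O || (r2 <= p.2)%O}
    & cut tau l1 r2].

Definition inside l1 r1 l2 r2 p := (l1 < p.1 < r1)%O && (l2 < p.2 < r2)%O.

Lemma sub_inside l1 r1 l2 r2 l1' r1' l2' r2' p :
  (l1 <= l1')%O -> (r1' <= r1)%O -> (l2 <= l2')%O -> (r2' <= r2)%O ->
  inside l1' r1' l2' r2' p -> inside l1 r1 l2 r2 p.
Proof.
move=> l1l r1r l2l r2r /andP[/andP[a b] /andP[c e]]; rewrite /inside.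
by rewrite (le_lt_trans l1l a) (lt_le_trans b r1r) (le_lt_trans l2l c)
  (lt_le_trans e r2r).
Qed.

Lemma slot_le_fst tau l1 r1 l2 r2 x : slot tau l1 r1 l2 r2 ->
  (l1 <= x < r1)%O -> le_fst tau x = le_fst tau l1.
Proof.
move=> [_ _ e1 _ _] /andP[lx xr]; apply: eq_in_count => p pt /=.
case/orP: (e1 p pt) => h; first by rewrite h (le_trans h lx).
rewrite [LHS]leNgt (lt_le_trans xr h) [RHS]leNgt.
by rewrite (lt_le_trans (le_lt_trans lx xr) h).
Qed.

Lemma slot_lt_fst tau l1 r1 l2 r2 x : slot tau l1 r1 l2 r2 ->
  (l1 < x <= r1)%O -> lt_fst tau x = le_fst tau l1.
Proof.
move=> [_ _ e1 _ _] /andP[lx xr]; apply: eq_in_count => p pt /=.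
case/orP: (e1 p pt) => h; first by rewrite h (le_lt_trans h lx).
rewrite [LHS]ltNge (le_trans xr h) [RHS]leNgt.
by rewrite (lt_le_trans lx (le_trans xr h)).
Qed.

Lemma slot_lt_snd tau l1 r1 l2 r2 y : slot tau l1 r1 l2 r2 ->
  (l2 < y <= r2)%O -> lt_snd tau y = lt_snd tau r2.
Proof.
move=> [_ _ _ e2 _] /andP[ly yr]; apply: eq_in_count => p pt /=.
case/orP: (e2 p pt) => h.
  by rewrite (le_lt_trans h ly) (lt_le_trans (le_lt_trans h ly) yr).
by rewrite [LHS]ltNge (le_trans yr h) [RHS]ltNge h.
Qed.

Lemma slot_stored tau l1 r1 l2 r2 q : slot tau l1 r1 l2 r2 ->
  q \in stored tau ->
  (q.1 <= l1)%O && (q.2 <= l2)%O || (r1 <= q.1)%O && (r2 <= q.2)%O.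
Proof.
move=> [lr1 lr2 e1 e2 c] qs; have qt := mem_stored qs.
case/orP: (e1 q qt) => h; rewrite h /=.
  case/orP: (e2 q qt) => [-> // | h2].
  by move: (c q qs); rewrite h [RHS]ltNge h2.
case/orP: (e2 q qt) => [h2 | ->]; last by rewrite orbT.
move: (c q qs); rewrite (le_lt_trans h2 lr2) => hl.
by move: (lt_le_trans lr1 h); rewrite ltNge hl.
Qed.

Lemma slot_compare tau l1 r1 l2 r2 p q : slot tau l1 r1 l2 r2 ->
  inside l1 r1 l2 r2 p -> q \in stored tau -> (p.1 < q.1)%O = (p.2 < q.2)%O.
Proof.
move=> sl /andP[/andP[a b] /andP[c e]] qs.
case/orP: (slot_stored sl qs) => /andP[h1 h2].
  by rewrite [LHS]ltNge (le_trans h1 (ltW a)) [RHS]ltNge (le_trans h2 (ltW c)).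
by rewrite (lt_le_trans b h1) (lt_le_trans e h2).
Qed.

Lemma twin_insert tau l1 r1 l2 r2 p : twin tau -> slot tau l1 r1 l2 r2 ->
  inside l1 r1 l2 r2 p -> twin (rcons tau p).
Proof.
move=> tw sl ip; have [_ _ e1 e2 _] := sl.
have /andP[/andP[a b] /andP[c e]] := ip.
apply: twin_rcons => //.
- apply/mapP => -[q qt pq]; move: (e1 q qt); rewrite -pq.
  by rewrite leNgt a leNgt b.
- apply/mapP => -[q qt pq]; move: (e2 q qt); rewrite -pq.
  by rewrite leNgt c leNgt e.
- by move=> q; apply: slot_compare sl ip.
Qed.

Lemma slot_insert tau l1 r1 l2 r2 p : slot tau l1 r1 l2 r2 ->
  inside l1 r1 l2 r2 p -> slot (rcons tau p) p.1 r1 p.2 r2.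
Proof.
move=> sl /andP[/andP[a b] /andP[c e]]; have [lr1 lr2 e1 e2 ct] := sl.
split=> // [q|q|q].
- rewrite mem_rcons inE => /orP[/eqP->|qt]; first by rewrite lexx.
  by case/orP: (e1 q qt) => h; rewrite ?h ?orbT // (le_trans h (ltW a)).
- rewrite mem_rcons inE => /orP[/eqP->|qt]; first by rewrite lexx.
  by case/orP: (e2 q qt) => h; rewrite ?h ?orbT // (le_trans h (ltW c)).
move=> /stored_rcons[-> | qs]; first by rewrite lexx e.
rewrite -(ct q qs).
case/orP: (slot_stored sl qs) => /andP[h _]; first by rewrite h (le_trans h (ltW a)).
by rewrite leNgt (lt_le_trans b h) leNgt (lt_le_trans lr1 h).
Qed.

(** Pairs are inserted in increasing order, each above the previous one in both streams. So the rank
    difference of each new pair equals the gap of the slot (written additively), and [a], the first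
    component of the last pair or [l1], gives with [r2] a cut of that same gap. *)
Lemma insert_pairs (dense : forall x y, (x < y)%O -> exists z, (x < z < y)%O)
    n tau l1 r1 l2 r2 :
  twin tau -> slot tau l1 r1 l2 r2 ->
  exists delta a,
    [/\ size delta = n, twin (tau ++ delta), all (inside l1 r1 l2 r2) delta,
        [/\ (l1 <= a < r1)%O, cut (tau ++ delta) a r2
          & le_fst (tau ++ delta) a = le_fst tau l1 + n]
      & {in delta, forall p, lt_fst (tau ++ delta) p.1 + lt_snd tau r2 =
                             lt_snd (tau ++ delta) p.2 + le_fst tau l1}].
Proof.
elim: n tau l1 l2 => [|n IHn] tau l1 l2 tw sl; have [lr1 lr2 _ _ ct] := sl.
  by exists [::], l1; rewrite cats0 lexx lr1 addn0.
have [a /andP[la ar]] := dense _ _ lr1; have [b /andP[lb br]] := dense _ _ lr2.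
have ip : inside l1 r1 l2 r2 (a, b) by rewrite /inside /= la ar lb br.
have [delta [x]] := IHn _ _ _ (twin_insert tw sl ip) (slot_insert sl ip).
rewrite cat_rcons => -[sz tw' ins [/= /andP[ax xr] ct' cx] rk].
have E1 : le_fst (rcons tau (a, b)) a = (le_fst tau l1).+1.
  by rewrite /le_fst -cats1 count_cat /= lexx addn0 addn1 -!/(le_fst _ _)
    (slot_le_fst sl) // (ltW la).
have E2 : lt_snd (rcons tau (a, b)) r2 = (lt_snd tau r2).+1.
  by rewrite /lt_snd -cats1 count_cat /= br addn0 addn1.
exists ((a, b) :: delta), x; split=> //=.
- by rewrite sz.
- rewrite ip /=; apply: sub_all ins => p.
  by apply: sub_inside => //; exact: ltW.
- by rewrite (le_trans (ltW la) ax) xr; split=> //; rewrite cx E1 addSnnS.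
move=> p; rewrite inE => /orP[/eqP->{p} /=|pd].
  have F1 : lt_fst (tau ++ (a, b) :: delta) a = le_fst tau l1.
    rewrite /lt_fst count_cat /= ltxx -/(lt_fst tau a).
    rewrite (slot_lt_fst sl) ?la ?(ltW ar) // add0n.
    rewrite (_ : count _ delta = 0) ?addn0 //; apply/eqP.
    rewrite -leqn0 leqNgt -has_count; apply/hasPn => q /(allP ins).
    by move=> /andP[/andP[h _] _]; rewrite -leNgt ltW.
  have F2 : lt_snd (tau ++ (a, b) :: delta) b = lt_snd tau r2.
    rewrite /lt_snd count_cat /= ltxx -/(lt_snd tau b).
    rewrite (slot_lt_snd sl) ?lb ?(ltW br) // add0n.
    rewrite (_ : count _ delta = 0) ?addn0 //; apply/eqP.
    rewrite -leqn0 leqNgt -has_count; apply/hasPn => q /(allP ins).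
    by move=> /andP[_ /andP[h _]]; rewrite -leNgt ltW.
  by rewrite F1 F2 addnC.
by move: (rk p pd); rewrite E1 E2 !addnS => -[].
Qed.

(** * Gaps of cuts, and the slot at a cut *)

Definition gap_cut tau l1 r1 l2 r2 x y (h : nat) : Prop :=
  [/\ (l1 <= x < r1)%O, (l2 < y <= r2)%O, cut tau x y
    & lt_snd tau y = le_fst tau x + h].

Definition max_gap_cut tau l1 r1 l2 r2 x y (h : nat) : Prop :=
  gap_cut tau l1 r1 l2 r2 x y h /\
  forall x' y' h', gap_cut tau l1 r1 l2 r2 x' y' h' -> h' <= h.

Lemma exists_max_gap_cut tau l1 r1 l2 r2 x y h :
  gap_cut tau l1 r1 l2 r2 x y h ->
  exists x' y' h', max_gap_cut tau l1 r1 l2 r2 x' y' h' /\ h <= h'.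
Proof.
move=> gc; pose P n := `[< exists x y, gap_cut tau l1 r1 l2 r2 x y n >].
have exP : exists n, P n by exists h; apply/asboolP; exists x, y.
have ubP n : P n -> n <= size tau.
  move=> /asboolP[x' [y' [_ _ _ e]]].
  have := count_size (fun p => p.2 < y')%O tau.
  by rewrite -/(lt_snd tau y') e; apply: leq_trans; rewrite leq_addl.
case: (ex_maxnP exP ubP) => m /asboolP[x' [y' gc']] mmax.
exists x', y', m; split; last by apply: mmax; apply/asboolP; exists x, y.
by split=> // x2 y2 h2 gc2; apply: mmax; apply/asboolP; exists x2, y2.
Qed.

(** The new ends are the least first component above [x] and the greatest second component below
    [y], or the old ends if there is none. This makes room for the second phase. *)
Lemma refine_slot tau l1 r1 l2 r2 x y h :
  gap_cut tau l1 r1 l2 r2 x y h ->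
  exists r1' l2', [/\ (r1' <= r1)%O, (l2 <= l2')%O & slot tau x r1' l2' y].
Proof.
move=> [/andP[_ xr] /andP[ly _] ct _].
have [r1' [rr xr' e1]] : exists r1', [/\ (r1' <= r1)%O, (x < r1')%O &
    {in tau, forall p, (p.1 <= x)%O || (r1' <= p.1)%O}].
  have [hs|/hasPn ns] := boolP (has (fun p => x < p.1 < r1)%O tau).
    have [m [_ /andP[xm mr]] mmin] := exists_argmin fst hs.
    exists m.1; rewrite (ltW mr) xm; split=> // p pt.
    case: leP => //= xp; case: (ltP p.1 r1) => pr.
      by apply: mmin; rewrite ?xp.
    exact: le_trans (ltW mr) pr.
  exists r1; split=> // p /ns; case: leP => //= xp.
  by rewrite -leNgt.
have [l2' [ll ly' e2]] : exists l2', [/\ (l2 <= l2')%O, (l2' < y)%O &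
    {in tau, forall p, (p.2 <= l2')%O || (y <= p.2)%O}].
  have [hs|/hasPn ns] := boolP (has (fun p => l2 < p.2 < y)%O tau).
    have [m [_ /andP[lm my]] mmin] := exists_argmin (U := U^d) snd hs.
    exists m.2; rewrite (ltW lm) my; split=> // p pt.
    case: (leP y) => //= [_ | py]; rewrite ?orbT // orbF.
    case: (ltP l2 p.2) => lp; last exact: le_trans lp (ltW lm).
    by apply: (mmin p pt); rewrite lp.
  exists l2; split=> // p /ns; case: (leP y) => //= [_ | py]; rewrite ?orbT //.
  by rewrite andbT -leNgt orbF.
by exists r1', l2'.
Qed.

(** * Few items between consecutive retained ones *)

Section Bucket.
Context (tau delta : seq (U * U)) (l1 r1 l2 r2 : U) (h0 h : nat).
Let sigma := tau ++ delta.
Hypothesis tw : twin sigma.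
Hypothesis sl : slot tau l1 r1 l2 r2.
Hypothesis ins : all (inside l1 r1 l2 r2) delta.
Hypothesis h0E : lt_snd tau r2 = le_fst tau l1 + h0.
Hypothesis rk : {in stored sigma, forall p, p \in delta ->
  lt_fst sigma p.1 + h0 <= lt_snd sigma p.2}.
Hypothesis hmax : forall x y h', gap_cut sigma l1 r1 l2 r2 x y h' -> h' <= h.

(** Pair [x] with the second component [y] of the next stored pair, or with [r2]. At least
    [le_fst sigma w + h0] second components lie below [y], so a gap of at most [h] leaves at most
    [h - h0] first components in the interval from [x] (excluded) to [w]. *)
Lemma gap_bucket x w : (l1 <= x < r1)%O -> (w < r1)%O ->
  {in stored sigma, forall q, ~~ (x < q.1 <= w)%O} ->
  le_fst sigma w + h0 <= le_fst sigma x + h.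
Proof.
move=> xr wr now; have [lr1 lr2 _ _ _] := sl; have [_ _ coh _] := tw.
(* [hmax] concerns non-negative gaps only; for a negative gap the truncated subtraction is 0. *)
have hmax' y : (l2 < y <= r2)%O -> cut sigma x y ->
    lt_snd sigma y <= le_fst sigma x + h.
  move=> yr ct; rewrite -leq_subLR; case: (leqP (le_fst sigma x) (lt_snd sigma y)).
    by move=> le; apply: (hmax (x := x) (y := y)); split=> //; rewrite subnKC.
  by move/ltnW; rewrite -subn_eq0 => /eqP ->.
have stP q : q \in stored sigma -> inside l1 r1 l2 r2 q \/
    (q.1 <= l1)%O && (q.2 <= l2)%O || (r1 <= q.1)%O && (r2 <= q.2)%O.
  by case/stored_cat => [/(allP ins)|/(slot_stored sl)]; auto.
have /andP[lx xr1] := xr.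
have [hs|/hasPn ns] := boolP (has (fun q => x < q.1 < r1)%O (stored sigma)).
  have [q [qs /andP[xq qr]] qmin] := exists_argmin fst hs.
  have qd : q \in delta.
    case/stored_cat: (qs) => // /(slot_stored sl)/orP[]/andP[g _].
      by move: (lt_le_trans xq g); rewrite ltNge lx.
    by move: (lt_le_trans qr g); rewrite ltxx.
  have /andP[_ /andP[lq2 qr2]] := allP ins q qd.
  have wq : (w < q.1)%O by move: (now q qs); rewrite xq /= -ltNge.
  have ct : cut sigma x q.2.
    move=> p ps; rewrite -(coherent_lt coh ps qs); case: (leP p.1 x) => px.
      by rewrite (le_lt_trans px xq).
    rewrite ltNge; symmetry; apply/negbTE; rewrite negbK.
    case: (ltP p.1 r1) => pr; first by apply: qmin; rewrite ?px.
    exact: le_trans (ltW qr) pr.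
  have := hmax' q.2; rewrite lq2 (ltW qr2) => /(_ isT ct); apply: leq_trans.
  apply: leq_trans (rk qs qd); rewrite leq_add2r; apply: sub_count => p /= pw.
  exact: le_lt_trans pw wq.
(* No stored first component lies strictly between [x] and [r1]. Now [h0E] replaces [rk], since all
   of [delta] lies below [r2]. *)
have ct : cut sigma x r2.
  move=> p ps; case: (leP p.1 x) => px.
    case: (stP p ps) => [/andP[_ /andP[_ ->]] //|/orP[]/andP[g g2]].
      by rewrite (le_lt_trans g2 lr2).
    by move: (lt_le_trans xr1 g); rewrite ltNge px.
  symmetry; apply/negbTE; rewrite -leNgt.
  move: (ns p ps); rewrite px /= -leNgt => rp.
  case: (stP p ps) => [/andP[/andP[_ g] _]|/orP[]/andP[g g2]] //.
    by move: (lt_le_trans g rp); rewrite ltxx.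
  by move: (le_lt_trans g (le_lt_trans lx px)); rewrite ltxx.
have := hmax' r2; rewrite lr2 lexx => /(_ isT ct); apply: leq_trans.
have -> : lt_snd sigma r2 = lt_snd tau r2 + size delta.
  rewrite /lt_snd count_cat; congr addn; apply/eqP; rewrite -all_count.
  by apply: sub_all ins => p /andP[_ /andP[_]].
rewrite h0E addnAC leq_add2r -(slot_lt_fst sl (x := r1)) ?lr1 ?lexx //.
apply: (@leq_trans (lt_fst sigma r1)).
  by apply: sub_count => p /= pw; exact: le_lt_trans pw wr.
by rewrite /lt_fst count_cat leq_add2l count_size.
Qed.

End Bucket.

(** Each [z] is assigned to the bucket of the greatest element of [X] not above it, which exists
    because [l] is a lower bound. *)
Lemma size_le_buckets (L X : seq U) l (B : nat) :
  l \in X -> {in L, forall z, (l <= z)%O} ->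
  {in X, forall x, count (fun z => (x <= z)%O &&
    ~~ has (fun x' => x < x' <= z)%O X) L <= B} ->
  size L <= size X * B.
Proof.
move=> lX lL cB.
set P := fun x z => (x <= z)%O && ~~ has (fun x' => x < x' <= z)%O X.
apply: (@leq_trans (\sum_(x <- X) count (P x) L)); last first.
  apply: (@leq_trans (\sum_(x <- X) B)); last first.
    by rewrite big_const_seq count_predT iter_addn_0 mulnC.
  rewrite big_seq [leqRHS]big_seq.
  by apply: leq_sum => x; exact: cB.
elim: L lL {cB} => [|z L IHL] lL //=.
rewrite big_split /= -add1n leq_add //; last first.
  by apply: IHL => y yL; apply: lL; rewrite inE yL orbT.
have hs : has (fun x => x <= z)%O X.
  by apply/hasP; exists l => //; apply: lL; rewrite mem_head.
have [m [mX mz] mmax] := exists_argmin (U := U^d) id hs.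
rewrite (big_rem m) //= {1}/P mz (_ : has _ _ = false) //.
apply/negbTE/hasPn => x xX; apply/negP => /andP[mx xz].
by move: (mmax x xX xz) => /=; rewrite leEdual /= leNgt mx.
Qed.

(** Only [x] itself is counted twice, and it occurs at most once. *)
Lemma count_interval_le tau x w : uniq (unzip1 tau) -> (x <= w)%O ->
  count (fun p => x <= p.1 <= w)%O tau + le_fst tau x <= (le_fst tau w).+1.
Proof.
move=> u xw; apply: (@leq_trans (le_fst tau w + count_mem x (unzip1 tau))).
  elim: tau {u} => //= p s IHs; rewrite /le_fst /= -!/(le_fst _ _).
  rewrite addnACA [leqRHS]addnACA leq_add //.
  by case: (ltgtP x p.1) => [xp|px|<-]; rewrite ?xw // (le_trans (ltW px) xw).
by rewrite count_uniq_mem // -addn1 leq_add2l; case: (_ \in _).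
Qed.

(* At the end of the second phase every bucket between consecutive retained
   pairs of the first phase contains few pairs of that phase.  The second phase
   was played between [x1] and [r'], so it affects only the bucket that
   contains this interval, and splitting that bucket at [r'] repairs it. *)
Lemma size_first_phase tau delta1 delta2 l1 r1 l2 r2 (h0 h : nat) x1 r' l' y1 :
  let sigma := tau ++ delta1 ++ delta2 in
  twin sigma -> slot tau l1 r1 l2 r2 ->
  all (inside l1 r1 l2 r2) (delta1 ++ delta2) ->
  lt_snd tau r2 = le_fst tau l1 + h0 ->
  {in stored sigma, forall p, p \in delta1 ++ delta2 ->
     lt_fst sigma p.1 + h0 <= lt_snd sigma p.2} ->
  (forall x y h', gap_cut sigma l1 r1 l2 r2 x y h' -> h' <= h) ->
  all (inside x1 r' l' y1) delta2 ->
  {in delta1, forall p, (p.1 <= x1)%O || (r' <= p.1)%O} ->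
  (l1 <= r')%O -> h0 <= h ->
  size delta1 <= (count (mem (stored sigma)) delta1 + 2) * (h - h0).+1.
Proof.
move=> sigma tw sl ins h0E rk hmax ins2 e1 lr' h0h.
have ins1 : all (inside l1 r1 l2 r2) delta1 by move: ins; rewrite all_cat => /andP[].
(* The bucket ends are the retained pairs of the first phase, [l1] to catch what lies below them,
   and the splitting point [r']: hence the summand 2. *)
set X := l1 :: r' :: [seq p.1 | p <- delta1 & p \in stored sigma].
have sX : size X = count (mem (stored sigma)) delta1 + 2.
  by rewrite /= size_map size_filter addn2.
have l1X x : x \in X -> (l1 <= x)%O.
  rewrite !inE => /or3P[/eqP-> //|/eqP-> //|/mapP[p]].
  by rewrite mem_filter => /andP[_ /(allP ins1)/andP[/andP[/ltW ? _] _]] ->.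
have inL z : z \in unzip1 delta1 -> (l1 < z < r1)%O.
  by case/mapP => p /(allP ins1)/andP[? _] ->.
rewrite -sX -(size_map fst delta1).
apply: (size_le_buckets (l := l1)); first exact: mem_head.
  by move=> z /inL/andP[/ltW].
move=> x xX; set P := fun z => _; have [hs|] := boolP (has P (unzip1 delta1)); last first.
  by rewrite has_count -leqNgt leqn0 => /eqP ->.
(* [w] is the greatest item of the bucket of [x]. *)
have [w [wL /andP[xw noX]] wmax] := exists_argmin (U := U^d) id hs.
have /andP[l1w wr1] := inL w wL.
have nost : {in stored sigma, forall q, ~~ (x < q.1 <= w)%O}.
  move=> q qs; apply/negP => /andP[xq qw].
  have noX' x' : x' \in X -> (x < x')%O -> (x' <= w)%O -> False.
    by move=> x'X h1 h2; case/hasP: noX; exists x'; rewrite ?h1.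
  case/stored_cat: (qs) => [|/(slot_stored sl)/orP[]/andP[g _]]; last first.
  - by move: (le_lt_trans (le_trans g qw) wr1); rewrite ltxx.
  - by move: (lt_le_trans xq (le_trans g (l1X x xX))); rewrite ltxx.
  rewrite mem_cat => /orP[qd|/(allP ins2)/andP[/andP[xq1 qr'] _]].
    apply: (noX' q.1) => //; rewrite !inE; apply/or3P; apply: Or33.
    by apply: map_f; rewrite mem_filter qs.
  (* A stored pair of the second phase lies strictly between [x1] and [r']. As [w] is from the first
     phase and above [x1], it is at least [r'], which would then be an end inside the bucket. *)
  have /mapP[p /e1 + wp] := wL; rewrite -wp => /orP[wx1|r'w].
    by move: (lt_le_trans xq1 (le_trans qw wx1)); rewrite ltxx.
  by apply: (noX' r') => //; [rewrite !inE eqxx orbT | apply: lt_trans qr'].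
have := gap_bucket tw sl ins h0E rk hmax _ wr1 nost.
rewrite (l1X x xX) (le_lt_trans xw wr1) => /(_ isT) gb.
have [u _ _ _] := tw; have ci := count_interval_le u xw.
have cL : count P (unzip1 delta1) <= count (fun p => x <= p.1 <= w)%O sigma.
  apply: (@leq_trans (count (fun z => x <= z <= w)%O (unzip1 delta1))).
    apply: sub_count_in => z zL Pz; have /andP[-> _] := Pz.
    exact: (wmax z zL Pz).
  rewrite count_map /sigma !count_cat addnCA leq_addr //.
apply: (leq_trans cL); rewrite -(leq_add2r (le_fst sigma x)).
apply: (leq_trans ci); rewrite addSn ltnS -(leq_add2r h0) addnAC subnK //.
by rewrite [leqRHS]addnC.
Qed.

(** * The recursive adversary and its space bound *)

Lemma space_gap_arith (n k P S S1 S2 Q h h1 h2 : nat) : 0 < P ->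
  n * P <= (Q + 2) * h.+1 -> h1 + h2 <= h -> S1 <= S -> S2 + Q <= S ->
  31 * k * n * P <= 512 * (S1 + k) * P + 2 * k * n * h1 ->
  31 * k * n * P <= 512 * (S2 + k) * P + 2 * k * n * h2 ->
  31 * k.+1 * n * (2 * P) <= 512 * (S + k.+1) * (2 * P) + 2 * k.+1 * n * h.
Proof.
move=> P0 nP hh S1S S2S I1 I2.
(* AM-GM on [512 * (Q + 2) * P] and [2 * n * h.+1], whose product is at least [(32 * n * P)^2].
   Replacing [h.+1] by [h] costs [2 * n], so 64 drops to 62. *)
have AG : 62 * (n * P) <= 512 * (Q + 2) * P + 2 * n * h.
  have : 64 * (n * P) <= 512 * (Q + 2) * P + 2 * n * h.+1.
    rewrite -leq_sqr; apply: leq_trans (nat_AGM2 _ _).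
    rewrite (_ : 4 * _ = 4096 * (n * P) * ((Q + 2) * h.+1)); last by ring.
    rewrite (_ : _ ^ 2 = 4096 * (n * P) * (n * P)); last by ring.
    by rewrite leq_mul2l nP orbT.
  have : n <= n * P by rewrite leq_pmulr.
  by rewrite mulnS; lia.
have K1 : k * n * (h1 + h2) <= k * n * h by rewrite leq_mul2l hh orbT.
have K2 : (S1 + S2 + Q) * P <= (S + S) * P by rewrite leq_mul2r -addnA leq_add ?orbT.
(* In the sum of [I1], [I2] and [AG] the terms in [Q] cancel, since [S1 + S2 + Q <= 2 * S]. *)
clear - AG K1 K2 I1 I2; nia.
Qed.

(** Space is a maximum over time, so [j] marks the moment at which it is measured. The excess
    [h - h0] over the initial gap is what adds up: the second phase starts from the gap [h1] that
    the first one reached. The rank condition on stored pairs is the invariant that the bucket count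
    needs. *)
Lemma adversary (dense : forall x y, (x < y)%O -> exists z, (x < z < y)%O)
    n k tau l1 r1 l2 r2 h0 :
  twin tau -> slot tau l1 r1 l2 r2 -> lt_snd tau r2 = le_fst tau l1 + h0 ->
  exists delta x y h j,
    [/\ size delta = n * 2 ^ k, twin (tau ++ delta),
        all (inside l1 r1 l2 r2) delta,
        {in stored (tau ++ delta), forall p, p \in delta ->
           lt_fst (tau ++ delta) p.1 + h0 <= lt_snd (tau ++ delta) p.2}
      & [/\ max_gap_cut (tau ++ delta) l1 r1 l2 r2 x y h, h0 <= h,
            j <= size delta
          & 31 * k * n * 2 ^ k <=
            512 * (count (mem (stored (tau ++ take j delta))) delta + k) * 2 ^ k
            + 2 * k * n * (h - h0)]].
Proof.
elim: k tau l1 r1 l2 r2 h0 => [|k IHk] tau l1 r1 l2 r2 h0 tw sl h0E.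
  have [delta [a [sz tw' ins [ar ct ca] rk]]] := insert_pairs dense n tw sl.
  have [_ lr2 _ _ _] := sl.
  have gc : gap_cut (tau ++ delta) l1 r1 l2 r2 a r2 h0.
    split=> //; first by rewrite lr2 lexx.
    rewrite ca addnAC -h0E /lt_snd count_cat -sz; congr addn.
    apply/eqP; rewrite -all_count; apply: sub_all ins => p.
    by case/andP=> _ /andP[].
  have [x [y [h [mgc h0h]]]] := exists_max_gap_cut gc.
  (* For [k = 0] the left side of the space bound is 0, so any prefix serves. *)
  exists delta, x, y, h, 0; split=> //; first by rewrite expn0 muln1.
  by move=> p _ pd; move: (rk p pd); rewrite h0E; clear; lia.
have [d1 [x1 [y1 [h1 [j1 [sz1 tw1 ins1 rk1 [[gc1 _] h01 j1s B1]]]]]]] :=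
  IHk _ _ _ _ _ _ tw sl h0E.
have [r' [l' [rr ll sl1]]] := refine_slot gc1.
have [/andP[lx1 xr1] /andP[ly1 yr1] ct1 g1] := gc1.
have [d2 [x2 [y2 [h2 [j2 [sz2 tw2 ins2 rk2 [[gc2 _] h12 j2s B2]]]]]]] :=
  IHk _ _ _ _ _ _ tw1 sl1 g1.
have [/andP[lx2 xr2] /andP[ly2 yr2] ct2 g2] := gc2.
have gc3 : gap_cut ((tau ++ d1) ++ d2) l1 r1 l2 r2 x2 y2 h2.
  split=> //.
    by rewrite (le_trans lx1 lx2) (lt_le_trans xr2 rr).
  by rewrite (le_lt_trans ll ly2) (le_trans yr2 yr1).
have [x [y [h [mgc h2h]]]] := exists_max_gap_cut gc3.
have ins : all (inside l1 r1 l2 r2) (d1 ++ d2).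
  rewrite all_cat ins1; apply: sub_all ins2 => p.
  exact: sub_inside.
(* Retained pairs of the first phase compare alike with all of [d2] in both streams, so their rank
   difference persists; stored pairs of the second have difference at least [h1], hence [h0]. *)
have rk : {in stored ((tau ++ d1) ++ d2), forall p, p \in d1 ++ d2 ->
    lt_fst ((tau ++ d1) ++ d2) p.1 + h0 <= lt_snd ((tau ++ d1) ++ d2) p.2}.
  move=> p ps; case/stored_cat: (ps) => [pd2 _ | ps1].
    by apply: leq_trans (rk2 p ps pd2); rewrite leq_add2l.
  rewrite mem_cat => /orP[pd1 | pd2]; last first.
    by apply: leq_trans (rk2 p ps pd2); rewrite leq_add2l.
  rewrite /lt_fst count_cat addnAC -/(lt_fst _ _) /lt_snd count_cat.
  apply: leq_add; first exact: rk1.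
  by apply: sub_count_in => q /(allP ins2) iq; rewrite (slot_compare sl1 iq ps1).
exists (d1 ++ d2), x, y, h.
move: (mgc) => [_ hmax]; move: ins rk hmax tw2 mgc h2h; rewrite -catA.
move=> ins rk hmax tw2' mgc h2h.
have h0h : h0 <= h by apply: leq_trans h2h; apply: leq_trans h12.
have e1 : {in d1, forall p, (p.1 <= x1)%O || (r' <= p.1)%O}.
  by case: sl1 => _ _ e _ _ p pd; apply: e; rewrite mem_cat pd orbT.
have lr' : (l1 <= r')%O by case: sl1 => xr _ _ _ _; apply: le_trans lx1 (ltW xr).
have Q1 := size_first_phase tw2' sl ins h0E rk hmax ins2 e1 lr' h0h.
set Q := count _ d1 in Q1.
set S1 := count (mem (stored (tau ++ take j1 d1))) d1 in B1.
set S2 := count (mem (stored ((tau ++ d1) ++ take j2 d2))) d2 in B2.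
have szd : size (d1 ++ d2) = n * 2 ^ k.+1.
  by rewrite size_cat sz1 sz2 -mulnDr addnn -mul2n expnS.
(* A first-phase pair stored at the end is stored at every moment of the second phase: once dropped,
   it could return only by arriving again, which distinctness excludes. *)
have QS : S2 + Q <= count (mem (stored (tau ++ take (size d1 + j2) (d1 ++ d2)))) (d1 ++ d2).
  rewrite take_cat ltnNge leq_addr /= addKn count_cat catA addnC leq_add2r.
  apply: sub_count_in => p pd1 /=.
  rewrite -{1}(cat_take_drop j2 d2) !catA => /stored_cat[pd2 | //].
  have : uniq (unzip1 (tau ++ d1 ++ d2)) by case: tw2'.
  rewrite /unzip1 !map_cat !cat_uniq => /and3P[_ _ /and3P[_ /hasPn h' _]].
  move: (h' p.1); rewrite (map_f fst (mem_drop pd2)) => /(_ isT).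
  by rewrite /= map_f.
have SS : S1 <= count (mem (stored (tau ++ take j1 (d1 ++ d2)))) (d1 ++ d2).
  by rewrite takel_cat // count_cat leq_addr.
have fin S : S1 <= S -> S2 + Q <= S -> 31 * k.+1 * n * 2 ^ k.+1 <=
    512 * (S + k.+1) * 2 ^ k.+1 + 2 * k.+1 * n * (h - h0).
  move=> S1S S2S; rewrite expnS.
  apply: (space_gap_arith (h1 := h1 - h0) (h2 := h2 - h1) _ _ _ S1S S2S B1 B2).
  - by rewrite expn_gt0.
  - by rewrite -sz1.
  - by clear - h01 h12 h2h; lia.
(* The moment of larger space among the two phases is chosen. *)
case: (leqP S1 (S2 + Q)) => cmp.
  exists (size d1 + j2); split=> //; split=> //.
    by rewrite size_cat leq_add2l.
  by apply: fin => //; apply: leq_trans QS.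
exists j1; split=> //; split=> //.
  by rewrite size_cat (leq_trans j1s) // leq_addr.
by apply: fin => //; apply: leq_trans SS; exact: ltnW.
Qed.

(** * The median guarantee bounds the gaps *)

Lemma lt_fst_lt_le_fst tau p x : p \in tau -> (p.1 <= x)%O ->
  lt_fst tau p.1 < le_fst tau x.
Proof.
move=> pt px; rewrite /lt_fst /le_fst !(permP (perm_to_rem pt)) /= ltxx px.
rewrite ltnS add0n; apply: sub_count => q /= qp.
exact: le_trans (ltW qp) px.
Qed.

End PairedRun.

(** The middle item of the sorted stream has rank within 1 of half the length. *)
Lemma exists_approx_median (R : realType) (d : Order.disp_t) (U : orderType d)
    (eps : R) (sigma : seq U) :
  uniq sigma -> (1 <= eps * (size sigma)%:R)%R ->
  exists a, approx_median eps sigma a.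
Proof.
case: sigma => [|x s] us; first by rewrite mulr0 ler10.
set sigma := x :: s => hn; set i := (size sigma)./2.
have szs : size (sort <=%O%O sigma) = size sigma by rewrite size_sort.
have isz : i < size (sort <=%O%O sigma).
  by rewrite szs ltn_half_double -addnn -[ltnLHS]addn0 ltn_add2l.
exists (nth x (sort <=%O%O sigma) i); split.
  by rewrite -(mem_sort <=%O%O) mem_nth.
have srt : sorted <%O%O (sort <=%O%O sigma) by rewrite sort_lt_sorted.
apply: le_trans hn; rewrite /item_rank.
rewrite -(count_sort <=%O%O) (count_lt_nth x srt isz).
have : ((size sigma)%:R = (odd (size sigma))%:R + 2 * i%:R :> R)%R.
  by rewrite -natrM -natrD -[in LHS](odd_double_half (size sigma)) -mul2n.
by move=> ->; case: odd => /=; rewrite ler_norml -natr1; lra.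
Qed.

(** Both runs output components of one stored pair. With a centred gap, a pair below the cut has
    first rank at least [h / 2] under the median, and a pair above it has second rank more than
    [h / 2] over the median. *)
Lemma centred_gap_le (R : realType) (d : Order.disp_t) (U : orderType d)
    (A : cb_algorithm) (eps : R) (sigma : seq (U * U)) (x y : U) (h : nat) :
  finds_approx_median U A eps -> twin A sigma -> cut A sigma x y ->
  lt_snd sigma y = le_fst sigma x + h ->
  size sigma = (le_fst sigma x).*2 + h ->
  (1 <= eps * (size sigma)%:R)%R ->
  (h%:R <= 2 * eps * (size sigma)%:R)%R.
Proof.
move=> fam [u1 u2 _ run2] ct hE szE hn.
have ex1 : exists a, approx_median eps (unzip1 sigma) a.
  by apply: exists_approx_median; rewrite ?size_map.
have ex2 : exists a, approx_median eps (unzip2 sigma) a.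
  by apply: exists_approx_median; rewrite ?size_map.
have [a1] := fam _ u1 ex1; have [a2] := fam _ u2 ex2.
rewrite /output run2 run_unzip1 !size_map !onth_map.
case E : (onth _ _) => [p|] //= [<-] [_ m2] [<-] [_ m1].
have ps : p \in stored A sigma by apply/onthP; eexists; exact: E.
move: m1 m2; rewrite !size_map /item_rank !count_map.
rewrite -/(lt_fst _ _) -/(lt_snd _ _) !ler_norml => /andP[m1 _] /andP[_ m2].
have szR : ((size sigma)%:R = 2 * (le_fst sigma x)%:R + h%:R :> R)%R.
  by rewrite szE natrD -mul2n natrM.
have := ct p ps; case: (leP p.1 x) => px py.
  have : ((lt_fst sigma p.1).+1%:R <= (le_fst sigma x)%:R :> R)%R.
    by rewrite ler_nat lt_fst_lt_le_fst // (mem_stored ps).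
  by move: m1; rewrite szR; lra.
have : ((le_fst sigma x + h)%:R <= (lt_snd sigma p.2)%:R :> R)%R.
  rewrite ler_nat -hE; apply: sub_count => q /= qy; apply: lt_le_trans qy _.
  by rewrite leNgt -py.
by move: m2; rewrite natrD -natr1 szR; lra.
Qed.

(** Padding outside the interval centres the gap and at most doubles the stream, so the factor 2
    becomes 4. *)
Lemma gap_le (R : realType) (d : Order.disp_t) (U : orderType d)
    (A : cb_algorithm) (eps : R) (delta : seq (U * U)) (l r x y : U)
    (h : nat) :
  unbounded_continuous U -> finds_approx_median U A eps -> (0 < eps)%R ->
  twin A delta -> all (inside l r l r) delta ->
  gap_cut A delta l r l r x y h -> (1 <= eps * (size delta)%:R)%R ->
  (h%:R <= 4 * eps * (size delta)%:R)%R.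
Proof.
move=> hU fam e0 tw ins [/andP[lx xr] /andP[ly yr] ct hE] hn.
have [_ unb _] := hU; have dense := exists_between hU.
suff [E [twE ctE hE' szE szN]] : exists E, [/\ twin A (delta ++ E),
    cut A (delta ++ E) x y,
    lt_snd (delta ++ E) y = le_fst (delta ++ E) x + h,
    size (delta ++ E) = (le_fst (delta ++ E) x).*2 + h
    & size E <= size delta].
  have sE : ((size (delta ++ E))%:R = (size delta)%:R + (size E)%:R :> R)%R.
    by rewrite size_cat natrD.
  have sN : ((size E)%:R <= (size delta)%:R :> R)%R by rewrite ler_nat.
  have hn' : (1 <= eps * (size (delta ++ E))%:R)%R.
    by apply: le_trans hn _; rewrite ler_pM2l // sE lerDl.
  apply: le_trans (centred_gap_le fam twE ctE hE' szE hn') _.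
  by rewrite sE; nra.
have uN : le_fst delta x + h <= size delta by rewrite -hE count_size.
(* A pair added below [l] raises [(le_fst delta x).*2 + h] by two and the length by one; a pair
   added above [r] raises only the length. *)
have [low|high] := leqP ((le_fst delta x).*2 + h) (size delta).
  have [[l' l'l] _] := unb l.
  have sl : slot A delta l' l l' l.
    split=> // p; last move=> /mem_stored; move=> /(allP ins).
    - by move=> /andP[/andP[/ltW -> _] _]; rewrite orbT.
    - by move=> /andP[_ /andP[/ltW -> _]]; rewrite orbT.
    - move=> /andP[/andP[h1 _] /andP[h2 _]].
      by rewrite leNgt (lt_trans l'l h1) ltNge (ltW h2).
  have [E [a [sz twE insE _ _]]] :=
    insert_pairs dense (size delta - ((le_fst delta x).*2 + h)) tw sl.
  have c1 : le_fst (delta ++ E) x = le_fst delta x + size E.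
    rewrite /le_fst count_cat; congr addn; apply/eqP; rewrite -all_count.
    apply: sub_all insE => p /andP[/andP[_ h1] _].
    exact: le_trans (ltW h1) lx.
  have c2 : lt_snd (delta ++ E) y = lt_snd delta y + size E.
    rewrite /lt_snd count_cat; congr addn; apply/eqP; rewrite -all_count.
    apply: sub_all insE => p /andP[_ /andP[_ h1]].
    exact: lt_trans h1 ly.
  exists E; split=> //.
  - move=> p /stored_cat[/(allP insE)/andP[/andP[_ h1] /andP[_ h2]]|]; last exact: ct.
    by rewrite (le_trans (ltW h1) lx) (lt_trans h2 ly).
  - by rewrite c1 c2 hE addnAC.
  - by rewrite c1 size_cat sz; clear - low; lia.
  - by rewrite sz leq_subr.
have [_ [r' rr']] := unb r.
have sl : slot A delta r r' r r'.
  split=> // p; last move=> /mem_stored; move=> /(allP ins).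
  - by move=> /andP[/andP[_ /ltW ->] _].
  - by move=> /andP[_ /andP[_ /ltW ->]].
  - move=> /andP[/andP[_ h1] /andP[_ h2]].
    by rewrite (ltW h1) (lt_trans h2 rr').
have [E [a [sz twE insE _ _]]] :=
  insert_pairs dense ((le_fst delta x).*2 + h - size delta) tw sl.
have c1 : le_fst (delta ++ E) x = le_fst delta x.
  rewrite /le_fst count_cat -[RHS]addn0; congr addn; apply/eqP.
  rewrite -leqn0 leqNgt -has_count; apply/hasPn => p /(allP insE).
  by move=> /andP[/andP[h1 _] _]; rewrite -ltNge (lt_trans xr h1).
have c2 : lt_snd (delta ++ E) y = lt_snd delta y.
  rewrite /lt_snd count_cat -[RHS]addn0; congr addn; apply/eqP.
  rewrite -leqn0 leqNgt -has_count; apply/hasPn => p /(allP insE).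
  by move=> /andP[_ /andP[h1 _]]; rewrite -leNgt (le_trans yr (ltW h1)).
exists E; split=> //.
- move=> p /stored_cat[/(allP insE)/andP[/andP[h1 _] /andP[h2 _]]|]; last exact: ct.
  by rewrite leNgt (lt_trans xr h1) ltNge (le_trans yr (ltW h2)).
- by rewrite c1 c2 hE.
- by rewrite c1 size_cat sz; clear - high; lia.
- by rewrite sz; clear - uN; lia.
Qed.

(** * From the adversary to the asymptotic statement *)

Section LowerBound.
Local Open Scope classical_set_scope.
Local Open Scope ring_scope.

Lemma ln2_le1 (R : realType) : ln (2 : R) <= 1.
Proof. by rewrite (_ : 2 = 1 + 1 :> R) //; apply: le_ln1Dx; lra. Qed.

Lemma space_lower_bound (R : realType) (d : Order.disp_t) (U : orderType d)
    (A : cb_algorithm) (eps : R) (n k : nat) :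
  unbounded_continuous U -> finds_approx_median U A eps ->
  0 < eps -> 1 <= eps * n%:R -> eps * n%:R <= 2 -> (100 <= n)%N ->
  exists sigma : seq U, [/\ uniq sigma, size sigma = (n * 2 ^ k)%N
    & (k * n <= 64 * items_stored A sigma)%N].
Proof.
move=> hU fam e0 en1 en2 n100; have [[l] unb _] := hU.
have [_ [r lr]] := unb l; have dense := exists_between hU.
have sl : slot A [::] l r l r by [].
have [delta [x [y [h [j [/= sz tw ins _ [[gc _] _ js B]]]]]]] :=
  adversary dense n k (twin_nil U A) sl (h0 := 0) erefl.
have e2k : 1 <= 2 ^+ k :> R by rewrite exprn_ege1 // ler1n.
have szR : (size delta)%:R = n%:R * 2 ^+ k :> R by rewrite sz natrM natrX.
have h8 : (h <= 8 * 2 ^ k)%N.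
  rewrite -(ler_nat R) natrM natrX.
  apply: le_trans (gap_le hU fam e0 tw ins gc _) _; rewrite szR mulrA.
    by rewrite -[leLHS]mulr1 ler_pM.
  by rewrite -!mulrA [eps * _]mulrA mulrA ler_wpM2r ?exprn_ge0 //; lra.
have [u1 _ _ _] := tw.
exists (unzip1 delta); split; rewrite ?size_map //.
have jlt : (j < (size (unzip1 delta)).+1)%N by rewrite size_map ltnS.
have S1 := leq_bigmax (F := fun i : 'I_(size (unzip1 delta)).+1 =>
  size (run A (take i (unzip1 delta))).2) (Ordinal jlt).
move: S1; rewrite -/(items_stored A _) /= -map_take run_unzip1 /= size_map => S1.
set S := count _ _ in B.
have S2 : (S <= size (stored A (take j delta)))%N.
  rewrite /S -size_filter; apply: uniq_leq_size; last first.
    by move=> p; rewrite mem_filter => /andP[].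
  by rewrite filter_uniq // (map_uniq u1).
have {S1 S2} SI := leq_trans S2 S1.
have P0 : (0 < 2 ^ k)%N by rewrite expn_gt0.
(* Here 15 is [31 - 2 * 8], by the bound on [h]. Then [n >= 100] lets [512 * k] be absorbed. *)
have B15 : (15 * (k * n) <= 512 * (S + k))%N.
  rewrite -(leq_pmul2r P0); move: B h8; rewrite subn0; clear; nia.
have : (k * 100 <= k * n)%N by rewrite leq_mul2l n100 orbT.
rewrite mulnC; move: B15 SI; clear; lia.
Qed.

(** Streams of length [n * 2 ^ k] with [n] just above [1 / eps] force [k * n / 64] items, whereas
    the logarithm is at most [2 * k] and the assumed bound thus at most [k * n / 100]. *)
Lemma no_small_space (R : realType) (d : Order.disp_t) (U : orderType d)
    (A : cb_algorithm) (s : nat -> R) (eps : R) :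
  unbounded_continuous U -> 0 < eps -> eps < 1 / 100 ->
  finds_approx_median U A eps -> stores_at_most U A s ->
  ~ \forall N \near \oo, s N <= 1 / 200 * space_bound eps N.
Proof.
move=> hU e0 e1 fam sam [N0 _ hN].
have ie0 : 0 <= eps^-1 by rewrite invr_ge0 ltW.
have /andP[] := truncn_itv ie0; set n := (Num.trunc _).+1 => nle ngt.
have eV : eps * eps^-1 = 1 by rewrite divff // gt_eqF.
have nle' : n%:R <= eps^-1 + 1 by rewrite -natr1 lerD2r.
have en1 : 1 <= eps * n%:R by rewrite -[leLHS]eV ler_pM2l // ltW.
have en2 : eps * n%:R <= 2.
  by apply: (@le_trans _ _ (eps * (eps^-1 + 1))); [rewrite ler_pM2l | lra].
have n100 : (100 <= n)%N by rewrite -(ler_nat R); nra.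
(* This makes the length at least [N0], and [k] positive. *)
set k := N0.+1.
have [sigma [us szs low]] := space_lower_bound k hU fam e0 en1 en2 n100.
have k2 : (N0 <= n * 2 ^ k)%N.
  apply: leq_trans (leq_pmull _ _); last by [].
  by apply: leq_trans (ltnW (ltn_expl _ _)); rewrite // leqnSn.
have := le_trans (sam _ us) (hN (size sigma) _); rewrite szs => /(_ k2).
rewrite /space_bound natrM natrX.
have k1 : 1 <= k%:R :> R by rewrite ler1n.
have lnk : ln (eps * (n%:R * 2 ^+ k)) <= 2 * k%:R.
  apply: (@le_trans _ _ (ln (2 ^+ k.+1))).
    rewrite ler_ln ?posrE ?exprn_gt0 //; last first.
      by rewrite mulrA mulr_gt0 ?exprn_gt0 // (lt_le_trans ltr01 en1).
    by rewrite mulrA exprS ler_wpM2r ?exprn_ge0.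
  rewrite lnXn // -[leLHS]mulr_natr; apply: (@le_trans _ _ (1 * k.+1%:R)).
    by rewrite ler_wpM2r // ln2_le1.
  by rewrite mul1r -[k.+1]addn1 natrD; lra.
move: low; rewrite -(ler_nat R) !natrM => low up.
have : 1 / eps * ln (eps * (n%:R * 2 ^+ k)) <= n%:R * (2 * k%:R).
  apply: (@le_trans _ _ (1 / eps * (2 * k%:R))).
    by rewrite ler_pM2l // div1r invr_gt0.
  by rewrite div1r ler_wpM2r ?mulr_ge0 // ltW.
have n1 : 1 <= n%:R :> R by rewrite ler1n.
have : 0 < k%:R * n%:R :> R by rewrite mulr_gt0 // (lt_le_trans ltr01).
by lra.
Qed.

End LowerBound.

Local Open Scope classical_set_scope.
Local Open Scope ring_scope.

Theorem theorem2 (R : realType) (d : Order.disp_t) (U : orderType d)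
    (hU : unbounded_continuous U) :
  exists eps0 c : R, [/\ 0 < eps0, 0 < c &
    forall eps : R, 0 < eps -> eps < eps0 ->
      (~ exists (A : cb_algorithm) (s : nat -> R),
           [/\ finds_approx_median U A eps,
               stores_at_most U A s
             & s =o_\oo (space_bound eps)])
      /\
      (~ exists (A : cb_algorithm) (s : nat -> R),
           [/\ finds_approx_median U A eps,
               stores_at_most U A s
             & \forall N \near \oo, s N <= c * space_bound eps N])].
Proof.
exists (1 / 100), (1 / 200); split; [lra | lra | move=> eps e0 e1].
split=> -[A [s [fam sam hs]]]; last exact: no_small_space hU e0 e1 fam sam hs.
apply: (no_small_space hU e0 e1 fam sam).
have c0 : 0 < 1 / 200 :> R by lra.
move/eqoP: hs => /(_ _ c0) hs.
near=> N.
have eN : 1 <= eps * N%:R.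
  rewrite mulrC -ler_pdivrMr //; near: N; exact: nbhs_infty_ger.
have sb : 0 <= space_bound eps N.
  by rewrite /space_bound mulr_ge0 ?ln_ge0 // div1r invr_ge0 ltW.
apply: le_trans (ler_norm _) _; rewrite -(ger0_norm sb).
by near: N.
Unshelve. all: by end_near.
Qed.
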